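(* For every integer $k>2$, $$\liminf_{n\to\infty}\frac{\mathrm{ex}_{C_{2k+1}}(n,K_3)}{n^2}>\frac{1}{5(2k+1)},$$ and moreover $$\lim_{k\to\infty}(2k+1)\liminf_{n\to\infty}\frac{\mathrm{ex}_{C_{2k+1}}(n,K_3)}{n^2}=\lim_{k\to\infty}(2k+1)\limsup_{n\to\infty}\frac{\mathrm{ex}_{C_{2k+1}}(n,K_3)}{n^2}=\frac14 .$$
   Context: For fixed nonempty simple graphs $F$ and $G$, $\mathrm{ex}_F(n,G)$ denotes the maximum number of pairwise edge-disjoint copies of $F$ that can be placed on an $n$-element vertex set so that the union of these copies contains no subgraph isomorphic to $G$ all of whose edges belong to pairwise different copies of $F$. $C_{2k+1}$ is the cycle of length $2k+1$ and $K_3$ the triangle. *)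

(* Defs.v *)
From mathcomp Require Import all_boot all_order all_algebra.

Set Implicit Arguments.
Unset Strict Implicit.
Unset Printing Implicit Defensive.

Record sgraph := SGraph {
  svertex :> finType;
  sedge : rel svertex;
  sedge_sym : symmetric sedge;
  sedge_irrefl : irreflexive sedge }.

Definition edge_set (F : sgraph) : {set {set F}} :=
  [set [set p.1; p.2] | p : F * F & sedge p.1 p.2].

(* A copy of F on the vertex set 'I_n is identified with its set of edges.
   When F has at least one edge, edge-disjoint copies have distinct edge sets,
   so counting edge sets is the same as counting the copies themselves. *)
Definition is_copy (F : sgraph) (n : nat) (C : {set {set 'I_n}}) : bool :=
  [exists f : {ffun F -> 'I_n},
    injectiveb f && (C == [set f @: (e : {set F}) | e in edge_set F])].

Definition edge_disjoint_copies (F : sgraph) (n : nat)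
    (D : {set {set {set 'I_n}}}) : bool :=
  [forall C in D, is_copy F C] && trivIset D.

(* All edges of H lie in the union of the copies in D, and belong to pairwise
   different copies (the members of D being pairwise disjoint). *)
Definition rainbow (n : nat) (D : {set {set {set 'I_n}}})
    (H : {set {set 'I_n}}) : bool :=
  (H \subset cover D) && [forall C in D, #|H :&: C| <= 1].

Definition rainbow_free (G : sgraph) (n : nat)
    (D : {set {set {set 'I_n}}}) : bool :=
  [forall H : {set {set 'I_n}}, is_copy G H ==> ~~ rainbow D H].

(* ex_F(n, G), for F and G with at least one edge. *)
Definition ex (F : sgraph) (n : nat) (G : sgraph) : nat :=
  \max_(D : {set {set {set 'I_n}}} |
      edge_disjoint_copies F D && rainbow_free G D) #|D|.

Definition complete_rel (m : nat) : rel 'I_m := [rel i j | i != j].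

Lemma complete_rel_sym m : symmetric (@complete_rel m).
Proof. by move=> i j; rewrite /complete_rel /= eq_sym. Qed.

Lemma complete_rel_irrefl m : irreflexive (@complete_rel m).
Proof. by move=> i; rewrite /complete_rel /= eqxx. Qed.

Definition complete_graph (m : nat) : sgraph :=
  SGraph (@complete_rel_sym m) (@complete_rel_irrefl m).

(* ordS is the successor modulo m; the result is the m-cycle for m >= 3. The
   condition i != j only matters for m = 1, where ordS has a fixed point. *)
Definition cycle_rel (m : nat) : rel 'I_m :=
  [rel i j | (i != j) && ((ordS i == j) || (ordS j == i))].

Lemma cycle_rel_sym m : symmetric (@cycle_rel m).
Proof. by move=> i j; rewrite /cycle_rel /= eq_sym orbC. Qed.

Lemma cycle_rel_irrefl m : irreflexive (@cycle_rel m).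
Proof. by move=> i; rewrite /cycle_rel /= eqxx. Qed.

Definition cycle_graph (m : nat) : sgraph :=
  SGraph (@cycle_rel_sym m) (@cycle_rel_irrefl m).

From mathcomp Require Import all_classical all_reals all_analysis.
Import Order.TTheory GRing.Theory Num.Theory.
Import numFieldNormedType.Exports.
Local Open Scope ring_scope.

(* Extended-real valued, so that the library's total limn_einf and limn_esup
   apply. The term at n = 0 is 0 / 0 = 0 and is irrelevant to the limits. *)
Definition ex_density (R : realType) (F G : sgraph) (n : nat) : \bar R :=
  ((ex F n G)%:R / n%:R ^+ 2)%:E.

(* Main.v *)
Require Import Defs.
From mathcomp Require Import all_boot all_order all_algebra.
From mathcomp Require Import zify ring lra.
Set Implicit Arguments.
Unset Strict Implicit.
Unset Printing Implicit Defensive.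

(* Let m = 2k + 1.

   Upper bound. If no triangle of the union of the packed cycles is rainbow,
   every triangle has two edges in a common cycle, so the number of triangles
   is at most the number e of edges; as the number of triangles is at least
   e (4 e - n^2) / (3 n), this gives 4 e <= n^2 + 3 n, where e = m |D|.

   Lower bound. We pack m-cycles into a blow-up of C_5 (which is triangle-free)
   with parts A1, ..., A5: A1 = X, the parts A2 and A5 are a copies of Z_q, and
   A3 and A4 are b copies of Z_q. The group Z_q translates A2, ..., A5 and fixes
   A1 pointwise, so each cycle consists of a vertex of A1 and a translate of a
   base path from A2 to A5. All translates are edge-disjoint as soon as the
   edges of the base paths have distinct colours, where the colour of an edge is
   its pair of copies of Z_q together with the difference of its endpoints. As
   A1 closes up every path, nothing constrains the differences used along a
   base path, which can hence be chosen greedily, losing only O(1) colours per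
   pair of copies. What remains is a balance of the number of times each pair is
   used: a base path zigzags between two consecutive parts, either A2 A3, A3 A4
   or A4 A5, with multiplicities making all pairs equally used. The weights
   (a, b) = (3, 4) beat 1 / (5 m) for every k > 2, and (a, b) = (1, L) gives the
   limit 1/4 when first k and then L goes to infinity. *)

(** * Copies of a graph, cycles and neighbourhoods *)

Lemma set2_eqP (T : finType) (a b c d : T) :
  [set a; b] = [set c; d] <-> (a = c /\ b = d) \/ (a = d /\ b = c).
Proof.
split=> [|[[-> ->]|[-> ->]]] //; last by rewrite setUC.
move=> E.
have /set2P[ac|ad] : a \in [set c; d] by rewrite -E set21.
  have /set2P[bc|bd] : b \in [set c; d] by rewrite -E set22.
    left; split=> //; have : d \in [set a; b] by rewrite E set22.
    by rewrite ac bc; case/set2P.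
  by left.
have /set2P[bc|bd] : b \in [set c; d] by rewrite -E set22.
  by right.
left; split=> //; have : c \in [set a; b] by rewrite E set21.
by rewrite ad bd; case/set2P.
Qed.

Definition copy_by (F : sgraph) (n : nat) (f : F -> 'I_n) : {set {set 'I_n}} :=
  [set f @: (e : {set F}) | e in edge_set F].

Lemma is_copyP (F : sgraph) (n : nat) (C : {set {set 'I_n}}) :
  reflect (exists2 f : F -> 'I_n, injective f & C = copy_by f) (is_copy F C).
Proof.
apply: (iffP existsP) => [[f /andP[/injectiveP fI /eqP ->]]|[f fI ->]].
  by exists f.
exists [ffun x => f x]; apply/andP; split.
  by apply/injectiveP => x y; rewrite !ffunE; apply: fI.
apply/eqP/eq_imset => e; apply: eq_imset => x; by rewrite ffunE.
Qed.

Lemma copy_byP (F : sgraph) (n : nat) (f : F -> 'I_n) (e : {set 'I_n}) :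
  reflect (exists i j, sedge i j /\ e = [set f i; f j]) (e \in copy_by f).
Proof.
apply: (iffP imsetP) => [[e' /imsetP[[i j] /=]]|[i [j [ij ->]]]].
  by rewrite inE /= => ij -> ->; exists i, j; rewrite imsetU1 imset_set1.
exists [set i; j]; last by rewrite imsetU1 imset_set1.
by apply/imsetP; exists (i, j); rewrite ?inE.
Qed.

Lemma copy_by_set2 (F : sgraph) (n : nat) (f : F -> 'I_n) (u v : 'I_n) :
  [set u; v] \in copy_by f -> exists i j, [/\ sedge i j, u = f i & v = f j].
Proof.
case/copy_byP=> i [j [ij /set2_eqP [[-> ->]|[-> ->]]]]; first by exists i, j.
by exists j, i; split; rewrite 1?sedge_sym.
Qed.

Lemma ordS_neq (m : nat) (i : 'I_m) : 1 < m -> ordS i != i.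
Proof.
move=> m1; rewrite -val_eqE /=; have := ltn_ord i.
rewrite leq_eqVlt => /orP[/eqP e|lt]; last by rewrite modn_small //; lia.
by rewrite e modnn; lia.
Qed.

Lemma ordS2_neq (m : nat) (i : 'I_m) : 2 < m -> ordS (ordS i) != i.
Proof.
move=> m1; rewrite -val_eqE /=; have := ltn_ord i.
rewrite leq_eqVlt => /orP[/eqP e|lt].
  by rewrite e modnn modn_small; lia.
rewrite (modn_small lt); move: lt.
rewrite leq_eqVlt => /orP[/eqP e|lt]; last by rewrite modn_small //; lia.
by rewrite e modnn; lia.
Qed.

Lemma cycle_sedgeP (m : nat) (i j : cycle_graph m) : 1 < m ->
  sedge i j = (j == ordS i) || (j == ord_pred i).
Proof.
move=> m1; rewrite /= (eq_sym j).
have -> : (j == ord_pred i) = (ordS j == i).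
  by apply/eqP/eqP => [->|<-]; rewrite ?ord_predK ?ordSK.
case: (eqVneq i j) => [->|].
  by rewrite orbb (negbTE (ordS_neq j m1)) cycle_rel_irrefl.
by move=> ij; rewrite /cycle_rel /= ij.
Qed.

Section Link.
Variable n : nat.
Implicit Types (C : {set {set 'I_n}}) (u v w : 'I_n).

(** The neighbourhood of [u] in the graph with edge set [C], used both for a single copy and for the
    union [cover D]. *)
Definition link C u : {set 'I_n} := [set w | [set u; w] \in C].

Lemma in_link C u w : (w \in link C u) = ([set u; w] \in C).
Proof. by rewrite inE. Qed.

Lemma link_sym C u w : (w \in link C u) = (u \in link C w).
Proof. by rewrite !inE setUC. Qed.

Lemma link_cycle m (f : cycle_graph m -> 'I_n) (i : 'I_m) : 1 < m ->
  injective f -> link (copy_by f) (f i) = [set f (ordS i); f (ord_pred i)].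
Proof.
move=> m1 fI; apply/setP=> w; rewrite in_link; apply/idP/set2P.
  case/copy_by_set2=> i' [j [ij /fI E ->]]; move: ij; rewrite -E cycle_sedgeP //.
  by case/orP=> /eqP->; [left|right].
case=> ->; apply/copy_byP; exists i.
  by exists (ordS i); rewrite cycle_sedgeP ?eqxx.
by exists (ord_pred i); rewrite cycle_sedgeP ?eqxx ?orbT.
Qed.

Lemma card_link_cycle m (f : cycle_graph m -> 'I_n) (i : 'I_m) : 2 < m ->
  injective f -> #|link (copy_by f) (f i)| = 2.
Proof.
move=> m2 fI; rewrite link_cycle ?(ltnW m2) // cards2.
rewrite (inj_eq fI) -(inj_eq (can_inj (@ordSK m))) ord_predK ordS2_neq //.
Qed.

Lemma link_copy_irrefl (F : sgraph) C u : is_copy F C -> u \notin link C u.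
Proof.
case/is_copyP=> f fI ->; apply/negP; rewrite in_link.
by case/copy_by_set2=> i [j [ij -> /fI E]]; rewrite E sedge_irrefl in ij.
Qed.

Lemma card_link_copy_le m C u : 2 < m -> is_copy (cycle_graph m) C ->
  #|link C u| <= 2.
Proof.
move=> m2 /is_copyP [f fI ->].
have [/codomP [i ->]|uf] := boolP (u \in codom f); first by rewrite card_link_cycle.
suff -> : link (copy_by f) u = set0 by rewrite cards0.
apply/setP=> w; rewrite in_link inE; apply/negP.
by case/copy_by_set2=> i [j [_ E _]]; case/codomP: uf; exists i.
Qed.

Lemma sum_card_link_copy m C : 2 < m -> is_copy (cycle_graph m) C ->
  2 * m <= \sum_u #|link C u|.
Proof.
move=> m2 /is_copyP [f fI ->].
rewrite (bigID [in f @: [set: 'I_m]]) /= big_imset /=; last by move=> i j _ _; apply: fI.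
apply: leq_trans (leq_addr _ _).
under eq_bigr => i _ do rewrite card_link_cycle //.
by rewrite sum_nat_const cardsT card_ord mulnC.
Qed.

End Link.

(** * Upper bound: counting triangles in the union of the cycles *)

Lemma sum_mem_trivIset (T : finType) (D : {set {set T}}) (x : T) :
  trivIset D -> \sum_(C in D) (x \in C) = (x \in cover D) :> nat.
Proof.
move=> tD; have mem1 (A : {set T}) : \sum_(y in A) (y == x) = (x \in A) :> nat.
  have [xA|xA] := boolP (x \in A).
    by rewrite (bigD1 x) //= eqxx big1 // => y /andP[_ /negbTE->].
  by rewrite big1 // => y yA; case: eqVneq => // yx; rewrite -yx yA in xA.
by rewrite -mem1 big_trivIset //; apply: eq_bigr => C _; rewrite mem1.
Qed.

(** Cauchy-Schwarz, by summing 2 d_i d_j <= d_i^2 + d_j^2 over all pairs. *)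
Lemma sqr_sum_le (n : nat) (d : 'I_n -> nat) :
  (\sum_i d i) ^ 2 <= n * \sum_i d i ^ 2.
Proof.
have E : \sum_(i < n) \sum_(j < n) (d i ^ 2 + d j ^ 2) = 2 * (n * \sum_i d i ^ 2).
  under [LHS]eq_bigr => i _ do rewrite big_split sum_nat_const card_ord /=.
  by rewrite big_split /= sum_nat_const card_ord -big_distrr /=; lia.
rewrite -(leq_pmul2l (isT : 0 < 2)) -E -mulnn big_distrl /= big_distrr /=.
apply: leq_sum => i _; rewrite big_distrr /= big_distrr /=.
by apply: leq_sum => j _; apply: nat_Cauchy.
Qed.

Section Upper.
Variables (m n : nat) (D : {set {set {set 'I_n}}}).
Hypotheses (m_gt2 : 2 < m) (D_copies : edge_disjoint_copies (cycle_graph m) D).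

Let copyD C : C \in D -> is_copy (cycle_graph m) C.
Proof. by case/andP: D_copies => /forall_inP H _; apply: H. Qed.

Let tD : trivIset D. Proof. by case/andP: D_copies. Qed.

Notation N u := (link (cover D) u).

Lemma mem_link_cover u v : v \in N u -> exists2 C, C \in D & v \in link C u.
Proof. by rewrite in_link => /bigcupP[C]; exists C; rewrite // in_link. Qed.

Lemma sub_link_cover u v C : C \in D -> v \in link C u -> v \in N u.
Proof. by rewrite !in_link => CD vC; apply/bigcupP; exists C. Qed.

Lemma link_cover_irrefl u : u \notin N u.
Proof.
apply/negP=> /mem_link_cover [C /copyD CD].
by apply/negP; apply: link_copy_irrefl CD.
Qed.

(** As the copies are edge-disjoint, a degree in the union is the sum of the degrees in the copies,
    and each m-cycle contributes 2 m in total. *)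
Lemma sum_card_link_cover : 2 * (m * #|D|) <= \sum_u #|N u|.
Proof.
have E u : #|N u| = \sum_(C in D) #|link C u|.
  rewrite -sum1dep_card big_mkcond /=.
  under [RHS]eq_bigr => C _ do rewrite -sum1dep_card big_mkcond /=.
  rewrite exchange_big /=; apply: eq_bigr => v _.
  have -> (b : bool) : (if b then 1 else 0) = b by case: b.
  by rewrite -sum_mem_trivIset //; apply: eq_bigr => C _.
under eq_bigr => u _ do rewrite E.
rewrite exchange_big /= mulnA mulnC -sum_nat_const.
by apply: leq_sum => C /copyD; apply: sum_card_link_copy.
Qed.

(** Two distinct edges at [u] in a common copy: this keeps a triangle through them from being
    rainbow. *)
Definition cherry (u v w : 'I_n) : bool :=
  (v != w) && [exists C in D, (v \in link C u) && (w \in link C u)].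

(** An edge uv lies in a single copy, and that copy has at most one other edge at [u]; so each
    ordered edge extends to at most one cherry. *)
Lemma sum_cherry : \sum_u \sum_v \sum_w cherry u v w <= \sum_u #|N u|.
Proof.
apply: leq_sum => u _; rewrite -sum1_card [leqRHS]big_mkcond /=.
apply: leq_sum => v _; case: ifPn => [/mem_link_cover [C CD vC]|vN]; last first.
  rewrite big1 // => w _; apply/eqP; rewrite eqb0; apply: contra vN.
  by case/andP=> _ /exists_inP[C CD /andP[vC _]]; apply: sub_link_cover CD vC.
apply: (@leq_trans #|link C u :\ v|); last first.
  by have := card_link_copy_le u m_gt2 (copyD CD); rewrite (cardsD1 v) vC.
rewrite -sum1_card [leqRHS]big_mkcond /=; apply: leq_sum => w _.
case ch : (cherry u v w) => //.
case/andP: ch => vw /exists_inP[C' CD' /andP[vC' wC']].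
suff E : C' = C by rewrite !inE eq_sym vw -E -in_link wC'.
apply/eqP/negPn/negP=> /(trivIsetP tD _ _ CD' CD)/pred0P/(_ [set u; v]) /=.
by rewrite -!in_link vC vC'.
Qed.

Hypothesis D_free : rainbow_free (complete_graph 3) D.

(** Without a cherry at any corner, no copy would contain two sides of the triangle, which would
    then be rainbow. *)
Lemma triangle_cherry u v w : v \in N u -> w \in N u -> w \in N v ->
  [|| cherry u v w, cherry v u w | cherry w u v].
Proof.
move=> uv uw vw; apply/negPn/negP; rewrite !negb_or => /and3P[nu nv nw].
have uDv : u != v by apply: contraTneq uv => ->; apply: link_cover_irrefl.
have uDw : u != w by apply: contraTneq uw => ->; apply: link_cover_irrefl.
have vDw : v != w by apply: contraTneq vw => ->; apply: link_cover_irrefl.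
pose f (i : complete_graph 3) : 'I_n := tnth [tuple u; v; w] i.
have fI : injective f.
  apply/(tuple_uniqP [tuple u; v; w]) => /=.
  by rewrite !inE negb_or uDv uDw vDw.
have fE e : e \in copy_by f -> [\/ e = [set u; v], e = [set u; w] | e = [set v; w]].
  case/copy_byP=> i [j [ij ->]]; case: i j ij => [[|[|[|//]]] i3] [[|[|[|//]]] j3] //= _;
    rewrite /f !(tnth_nth u) /=;
    by [constructor 1|constructor 2|constructor 3
       |rewrite setUC; constructor 1|rewrite setUC; constructor 2|rewrite setUC; constructor 3].
move/forallP/(_ (copy_by f))/implyP: D_free => /(_ _)/negP[].
  by apply/is_copyP; exists f.
apply/andP; split.
  by apply/subsetP=> e /fE[] ->; rewrite -in_link.
have no a b c C : ~~ cherry a b c -> b != c -> C \in D ->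
    [set a; b] \in C -> [set a; c] \in C -> False.
  move=> /negP nch bc CD ab ac; apply: nch; rewrite /cherry bc /=.
  by apply/exists_inP; exists C; rewrite // !in_link ab.
apply/forall_inP=> C CD; apply/card_le1_eqP=> x y.
rewrite !inE => /andP[/fE xE xC] /andP[/fE yE yC].
have nu' := no _ _ _ _ nu vDw CD; have nv' := no _ _ _ _ nv uDw CD.
have nw' := no _ _ _ _ nw uDv CD.
move: xC yC; rewrite ![[set v; u]]setUC ![[set w; _]]setUC in nv' nw'.
by case: xE => ->; case: yE => -> // xC yC; exfalso; eauto.
Qed.

(** Let S be the degree sum and T the number of ordered triangles. Each triangle has a cherry at one
    of three corners, so T <= 3 S. Summing d(u) + d(v) <= n + |N(u) :&: N(v)| over ordered edges
    gives 2 sum d^2 <= n S + T. With S^2 <= n sum d^2 this yields 2 S^2 <= (n^2 + 3 n) S, and S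
    cancels. *)
Lemma sum_card_link_cover_le : 2 * \sum_u #|N u| <= n ^ 2 + 3 * n.
Proof.
set S := \sum_u _.
pose T := \sum_u \sum_(v in N u) #|N u :&: N v|.
have T_le : T <= 3 * S.
  have -> : T = \sum_u \sum_v \sum_w [&& v \in N u, w \in N u & w \in N v].
    apply: eq_bigr => u _; rewrite big_mkcond /=; apply: eq_bigr => v _.
    case: (v \in N u); last by rewrite big1.
    rewrite -sum1_card big_mkcond /=; apply: eq_bigr => w _.
    by rewrite inE /=; case: (_ && _).
  apply: (@leq_trans (\sum_u \sum_v \sum_w
      (cherry u v w + cherry v u w + cherry w u v))).
    do 3![apply: leq_sum => ? _]; case: and3P => // -[/triangle_cherry H /H {}H /H].
    by do 3![case: cherry].
  under eq_bigr => u _ do (under eq_bigr => v _ do rewrite !big_split /=;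
    rewrite !big_split /=).
  rewrite !big_split /= !mulSn mul0n addn0 addnA.
  apply: leq_add; first apply: leq_add; first exact: sum_cherry.
    by rewrite exchange_big; apply: sum_cherry.
  under eq_bigr => u _ do rewrite exchange_big /=.
  by rewrite exchange_big; apply: sum_cherry.
have sq_le : 2 * \sum_u #|N u| ^ 2 <= n * S + T.
  have -> : 2 * \sum_u #|N u| ^ 2 = \sum_u \sum_(v in N u) (#|N u| + #|N v|).
    under [RHS]eq_bigr => u _ do rewrite big_split sum_nat_const /= mulnn.
    rewrite big_split /= mul2n -addnn; congr (_ + _).
    under [RHS]eq_bigr => u _ do rewrite big_mkcond.
    rewrite exchange_big /=; apply: eq_bigr => v _.
    rewrite -big_mkcond /= -mulnn -sum_nat_const.
    by apply: eq_bigl => u; rewrite link_sym.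
  rewrite /S big_distrr -big_split /=; apply: leq_sum => u _.
  rewrite mulnC -sum_nat_const -big_split /=; apply: leq_sum => v _.
  by rewrite -cardsUI leq_add2r -[leqRHS]card_ord max_card.
have [->//|S_gt0] := posnP S.
have := sqr_sum_le (fun u => #|N u|); rewrite -/S => CS.
rewrite -(leq_pmul2r S_gt0) -mulnn; nia.
Qed.

End Upper.

Theorem ex_cycle_triangle_le (m n : nat) : 2 < m ->
  4 * (m * ex (cycle_graph m) n (complete_graph 3)) <= n ^ 2 + 3 * n.
Proof.
move=> m2; rewrite mulnCA mulnA /ex.
elim/big_ind: _ => [|x y|D /andP[Dc Df]]; first by rewrite muln0.
  by rewrite /maxn; case: ifP.
have := sum_card_link_cover_le m2 Dc Df; have := sum_card_link_cover m2 Dc; lia.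
Qed.

(** * Lower bound: packings over a triangle-free graph *)

Definition triangle_free (H : sgraph) : Prop :=
  forall a b c : H, sedge a b -> sedge b c -> ~~ sedge a c.

Lemma cycle5_triangle_free : triangle_free (cycle_graph 5).
Proof.
have E (i j : cycle_graph 5) : sedge i j =
   (j %% 5 == i.+1 %% 5) || (i %% 5 == j.+1 %% 5).
  move: i j; do 2![case=> [[|[|[|[|[|//]]]]] ?]]; by [].
by do 3![case=> [[|[|[|[|[|//]]]]] ?]]; rewrite !E.
Qed.

(** [lev] is a homomorphism from the union of the copies to the triangle-free graph [H], so the
    union has no triangle at all, rainbow or not. Quantifying disjointness over ordered edges covers
    both orientations of a shared edge. *)
Lemma ex_triangle_ge (F H : sgraph) (n : nat) (K V : finType)
    (f : K -> F -> V) (lev : V -> H) :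
  (exists i j : F, sedge i j) -> #|V| <= n -> (forall k, injective (f k)) ->
  (forall k k' i j i' j', sedge i j -> sedge i' j' ->
     f k i = f k' i' -> f k j = f k' j' -> k = k') ->
  triangle_free H ->
  (forall k i j, sedge i j -> sedge (lev (f k i)) (lev (f k j))) ->
  #|K| <= ex F n (complete_graph 3).
Proof.
move=> [i0 [j0 ij0]] Vn fI f_disj H_free f_hom.
pose h x : 'I_n := widen_ord Vn (enum_rank x).
have hI : injective h by move=> x y /(congr1 val) /= /val_inj/enum_rank_inj.
pose C k := copy_by (fun i => h (f k i)).
have C_disj k k' e : e \in C k -> e \in C k' -> k = k'.
  case/copy_byP=> i [j [ij ->]] /copy_by_set2 [i' [j' [ij' /hI ii /hI jj]]].
  exact: f_disj ij ij' ii jj.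
have mem0 k : [set h (f k i0); h (f k j0)] \in C k.
  by apply/copy_byP; exists i0, j0.
have CI : injective C by move=> k k' E; apply: (C_disj _ _ _ (mem0 k)); rewrite -E.
rewrite -(card_imset predT CI) /ex.
apply: (bigmax_sup (C @: predT)) => //; apply/andP; split.
  apply/andP; split.
    apply/forall_inP=> _ /imsetP[k _ ->]; apply/is_copyP.
    by exists (fun i => h (f k i)) => // i j /hI/fI.
  apply/trivIsetP=> _ _ /imsetP[k _ ->] /imsetP[k' _ ->] neq.
  apply/pred0P=> e /=; apply/negP=> /andP[ek ek'].
  by rewrite (C_disj _ _ _ ek ek') eqxx in neq.
apply/forallP=> T; apply/implyP=> /is_copyP[phi phiI ->].
apply/negP=> /andP[/subsetP sub _].
have edge (i j : 'I_3) : i != j -> exists x y,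
    [/\ phi i = h x, phi j = h y & sedge (lev x) (lev y)].
  move=> ij; have /sub : [set phi i; phi j] \in copy_by (phi : complete_graph 3 -> _).
    by apply/copy_byP; exists i, j.
  case/bigcupP=> _ /imsetP[k _ ->] /copy_by_set2[a [b [ab -> ->]]].
  by exists (f k a), (f k b); split=> //; apply: f_hom.
have [x [y [ex ey xy]]] := edge (@Ordinal 3 0 isT) (@Ordinal 3 1 isT) isT.
have [y' [z [ey' ez yz]]] := edge (@Ordinal 3 1 isT) (@Ordinal 3 2 isT) isT.
have [x' [z' [ex' ez' xz]]] := edge (@Ordinal 3 0 isT) (@Ordinal 3 2 isT) isT.
move: ex' ey' ez'; rewrite ex ey ez => /hI ? /hI ? /hI ?; subst x' y' z'.
by have := H_free _ _ _ xy yz; rewrite xz.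
Qed.

(** * Greedy lifting of walks with distinct colours *)

Lemma card_preim_le (T : finType) (T' : eqType) (g : T -> T') (s : seq T') (a : pred T') :
  injective g -> (forall x, a (g x)) -> #|[set x | g x \in s]| <= count a s.
Proof.
move=> gI ag; rewrite cardE -(size_map g) -size_filter.
apply: uniq_leq_size; first by rewrite map_inj_uniq ?enum_uniq.
by move=> y /mapP[x]; rewrite mem_enum inE => gx ->; rewrite mem_filter ag.
Qed.

Lemma uniq_flatten_map (T T' : eqType) (F : T -> seq T') (r : seq T) :
  uniq (flatten [seq F k | k <- r]) ->
  (forall k, k \in r -> uniq (F k)) /\
  (forall k k' c, k \in r -> k' \in r -> c \in F k -> c \in F k' -> k = k').
Proof.
elim: r => [|k0 r IH] //=; rewrite cat_uniq => /and3P[u0 /hasPn no /IH[u d]].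
split=> [k|k k' c]; rewrite !inE.
  by case/predU1P=> [->|/u].
have {}no k1 : k1 \in r -> c \in F k1 -> c \notin F k0.
  by move=> k1r ck1; apply: no; apply/flatten_mapP; exists k1.
case/predU1P=> [->|kr]; case/predU1P=> [->|k'r] // ck ck'.
- by have := no _ k'r ck'; rewrite ck.
- by have := no _ kr ck; rewrite ck'.
- exact: d ck ck'.
Qed.

Definition links (A B : Type) (c : A -> A -> B) (s : seq A) : seq B :=
  if s is x :: s' then pairmap c x s' else [::].

Lemma size_links (A B : Type) (c : A -> A -> B) (s : seq A) :
  size (links c s) = (size s).-1.
Proof. by case: s => //= x s; rewrite size_pairmap. Qed.

Lemma nth_links (A B : Type) (c : A -> A -> B) (a0 : A) (b0 : B) (s : seq A) (i : nat) :
  i.+1 < size s -> nth b0 (links c s) i = c (nth a0 s i) (nth a0 s i.+1).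
Proof. by case: s => //= x s i_lt; rewrite (nth_pairmap a0). Qed.

Section Greedy.
Import GRing.Theory.
Local Open Scope ring_scope.
Variables (I : finType) (sd : pred I) (q' : nat).
Notation q := q'.+1.
Notation P := (I * 'I_q)%type.

(** The endpoint on the side [sd] is put last, so that an edge between the two sides gives the same
    pair in both directions. *)
Definition step (u v : I) : I * I := if sd u then (v, u) else (u, v).

(** For an edge between the two sides, this is its orbit under translation by Z_q, independently of
    the orientation. *)
Definition color (p r : P) : (I * I) * 'I_q :=
  (step p.1 r.1, if sd p.1 then p.2 - r.2 else r.2 - p.2).

Definition translate (tau : 'I_q) (p : P) : P := (p.1, p.2 + tau).

Lemma translateK tau : cancel (translate tau) (translate (- tau)).
Proof. by case=> u a; rewrite /translate /= addrK. Qed.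

Lemma translate_inj tau tau' p : translate tau p = translate tau' p -> tau = tau'.
Proof. by move/(congr1 snd)/addrI. Qed.

Lemma color_translate tau p r : color (translate tau p) (translate tau r) = color p r.
Proof. by rewrite /color /=; case: ifP => _; rewrite opprD addrACA subrr addr0. Qed.

Lemma color_sym p r : sd p.1 != sd r.1 -> color p r = color r p.
Proof. by rewrite /color /step; case: (sd p.1); case: (sd r.1). Qed.

Lemma map_links_color s : map fst (links color s) = links step (map fst s).
Proof. by case: s => //= p s; elim: s p => //= r s IH p; rewrite IH. Qed.

(** The walk is lifted from its end backwards; [U] holds the colours already taken. Only the residue
    of each new vertex is free, and the bound leaves an admissible one. *)
Lemma extend_walk (U : seq ((I * I) * 'I_q)) (w : seq I) :
  uniq U ->
  (forall e, count_mem e (links step w ++ map fst U) + size w <= q)%N ->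
  exists s, [/\ map fst s = w, uniq s & uniq (links color s ++ U)].
Proof.
move=> uU; elim: w => [|u w IH] bound; first by exists [::].
case: w IH bound => [|v w] IH bound; first by exists [:: (u, 0)].
have [|[|p s] [//= [pv sw]]] := IH.
  by move=> e; have := bound e; rewrite /=; lia.
rewrite -/(links color (p :: s)); set L := _ ++ U => us uL.
suff [xi ok] : exists xi : 'I_q, ((u, xi) \notin p :: s) && (color (u, xi) p \notin L).
  case/andP: ok => xi_s xi_L; exists [:: (u, xi), p & s]; split.
  - by rewrite /= pv sw.
  - by rewrite cons_uniq xi_s.
  - by rewrite [links _ _]/= cat_cons cons_uniq xi_L.
(* If all q residues were bad, each would repeat a vertex of the walk or a colour. The first kind is
   bounded by the length, the second by the number of taken colours over the pair [step u v], since
   the residue determines the colour injectively. *)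
apply/existsP; apply: contraT; rewrite negb_exists => /forallP bad.
have := bound (step u v); have := cardsT 'I_q; rewrite card_ord.
have /subset_leq_card le : [set: 'I_q] \subset
    [set xi | (u, xi) \in p :: s] :|: [set xi | color (u, xi) p \in L].
  by apply/subsetP=> xi _; have := bad xi; rewrite negb_and !negbK !inE.
have le1 : (#|[set xi | (u, xi) \in p :: s]| <= size (p :: s))%N.
  rewrite -(count_predT (p :: s)).
  by apply: (@card_preim_le _ _ (fun xi => (u, xi)) (p :: s) predT) => [x y []|].
have le2 : (#|[set xi | color (u, xi) p \in L]| <= count_mem (step u v) (map fst L))%N.
  rewrite count_map; apply: (@card_preim_le _ _ (fun xi => color (u, xi) p)) => /=.
    move=> x y /(congr1 snd) /=.
    by case: (sd u) => [/addIr|/addrI/oppr_inj].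
  by move=> xi; rewrite /= /color pv.
have cL : count_mem (step u v) (map fst L) =
   count_mem (step u v) (links step (v :: w) ++ map fst U).
  by rewrite /L map_cat map_links_color /= pv sw.
have sz : size (p :: s) = size (v :: w) by rewrite /= -sw size_map.
rewrite [links _ _]/= cat_cons /= eqxx => cT B.
have := leq_trans (leq_trans le (leq_card_setU _ _)) (leq_add le1 le2).
by rewrite cT cL sz /=; move: B; set c := count_mem _ _; lia.
Qed.

(** The walks are lifted one after another. Colours must differ over all walks, but vertices only
    within one walk, because edge-disjoint cycles may share vertices. *)
Lemma greedy_walks (J : eqType) (W : J -> seq I) (r : seq J) (M : nat) :
  uniq r -> (forall k, size (W k) <= M)%N ->
  (forall e, count_mem e (flatten [seq links step (W k) | k <- r]) + M <= q)%N ->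
  exists L : J -> seq P,
    (forall k, k \in r -> map fst (L k) = W k /\ uniq (L k)) /\
    uniq (flatten [seq links color (L k) | k <- r]).
Proof.
move=> + szM; elim: r => [|k r IH] /=; first by exists (fun _ => [::]).
case/andP=> kr ur bound.
have [e|L [Lok Lu]] := IH ur.
  by apply: leq_trans (bound e); rewrite count_cat leq_add2r leq_addl.
have [e|s [sW us uU]] := extend_walk (w := W k) Lu.
  apply: leq_trans (leq_trans (leq_add _ (szM k)) (bound e)) => //.
  rewrite !count_cat map_flatten -map_comp leq_add2l.
  have E : {in r, [eta map fst \o (fun k => links color (L k))] =1 fun k => links step (W k)}.
    by move=> j jr /=; rewrite map_links_color; have [->] := Lok j jr.
  by move/eq_in_map: E => /= ->.
exists (fun j => if j == k then s else L j); split.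
  move=> j; rewrite inE; case: eqP => [-> _|_] //=; exact: Lok.
rewrite eqxx; suff -> : [seq links color (if j == k then s else L j) | j <- r] =
   [seq links color (L j) | j <- r] by [].
by apply/eq_in_map=> j jr; case: eqP => // jk; rewrite -jk jr in kr.
Qed.

End Greedy.

(** * From lifted base paths to edge-disjoint cycles *)

Section Assemble.
Import GRing.Theory.
Variables (I B X : finType) (lev : I -> cycle_graph 5) (q' l : nat).
Notation q := q'.+1.
Notation P := (I * 'I_q)%type.
Variable W : B * X -> seq I.
Hypothesis lev_neq0 : forall u, lev u != ord0.
Hypothesis size_W : forall k, size (W k) = l.+1.
Hypothesis W_path : forall k u0 i, i < l ->
  sedge (lev (nth u0 (W k) i)) (lev (nth u0 (W k) i.+1)).
Hypothesis W_first : forall k u0, lev (nth u0 (W k) 0) = 1%R.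
Hypothesis W_last : forall k u0, lev (nth u0 (W k) l) = 4%R.
Hypothesis W_first_inj : forall k k' u0, k.2 = k'.2 ->
  nth u0 (W k) 0 = nth u0 (W k') 0 -> k = k'.
Hypothesis W_last_inj : forall k k' u0, k.2 = k'.2 ->
  nth u0 (W k) l = nth u0 (W k') l -> k = k'.

Let sd (u : I) := odd (lev u).
Notation col := (@color I sd q').

(** Away from 0 the pentagon is the path 1, 2, 3, 4, which is bipartite by parity. *)
Lemma sedge_sd u v : sedge (lev u) (lev v) -> sd u != sd v.
Proof.
move: (lev_neq0 u) (lev_neq0 v); rewrite /sd.
by move: (lev u) (lev v); do 2![case=> [[|[|[|[|[|//]]]]] ?]].
Qed.

Variables (u0 : I) (L : B * X -> seq P).
Hypothesis LW : forall k, map fst (L k) = W k.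
Hypothesis L_uniq : forall k, uniq (L k).
Hypothesis L_color_uniq : forall k, uniq (links col (L k)).
Hypothesis L_color_inj : forall k k' c,
  c \in links col (L k) -> c \in links col (L k') -> k = k'.

Let p0 : P := (u0, 0%R).
Notation V := (X + P)%type.

Definition blowup_lev (v : V) : cycle_graph 5 :=
  if v is inr p then lev p.1 else 0%R.

Lemma size_L k : size (L k) = l.+1.
Proof. by rewrite -(size_W k) -LW size_map. Qed.

Lemma nth_L k i : i <= l -> (nth p0 (L k) i).1 = nth u0 (W k) i.
Proof. by move=> il; rewrite -LW (nth_map p0) ?size_L. Qed.

(** Position 0 is the apex in A1, and position i + 1 is the i-th vertex of the translated lift. *)
Definition cycle_vertex (k : B * X * 'I_q) (i : 'I_l.+2) : V :=
  nth (inl k.1.2) (inl k.1.2 :: [seq inr (translate k.2 p) | p <- L k.1]) i.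

(** The edges of a cycle in a fixed direction: from the apex to either end of the path, or forward
    along the path. *)
Definition cycle_link (k : B * X * 'I_q) (a c : V) : Prop :=
  (exists2 i, (i == 0) || (i == l) &
     a = inl k.1.2 /\ c = inr (translate k.2 (nth p0 (L k.1) i))) \/
  (exists2 i, i < l & a = inr (translate k.2 (nth p0 (L k.1) i)) /\
                      c = inr (translate k.2 (nth p0 (L k.1) i.+1))).

Lemma cycle_vertexS k (i : 'I_l.+2) j : i = j.+1 :> nat ->
  cycle_vertex k i = inr (translate k.2 (nth p0 (L k.1) j)).
Proof.
move=> E; have := ltn_ord i; rewrite /cycle_vertex E ltnS => jl /=.
by rewrite (nth_map p0) ?size_L.
Qed.

Lemma cycle_vertex0 k (i : 'I_l.+2) : i = 0 :> nat -> cycle_vertex k i = inl k.1.2.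
Proof. by rewrite /cycle_vertex => ->. Qed.

Lemma cycle_linkP k (i j : cycle_graph l.+2) : sedge i j ->
  cycle_link k (cycle_vertex k i) (cycle_vertex k j) \/
  cycle_link k (cycle_vertex k j) (cycle_vertex k i).
Proof.
wlog -> : i j / j = ordS i.
  move=> H /[dup] ij /andP[_ /orP[/eqP E|/eqP E]]; first by apply: H.
  by have := H _ _ (esym E); rewrite sedge_sym or_comm; apply.
move=> _; have := ltn_ord i; rewrite leq_eqVlt => /orP[/eqP[il]|il].
  right; rewrite (@cycle_vertex0 k (ordS i)); last by rewrite /= il modnn.
  by rewrite (cycle_vertexS k il); left; exists l; rewrite ?eqxx ?orbT.
left; have iS : ordS i = i.+1 :> nat by rewrite /= modn_small.
rewrite (cycle_vertexS k iS); case E : (nat_of_ord i) => [|j0].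
  by rewrite cycle_vertex0 //; left; exists 0.
by rewrite (cycle_vertexS k E); right; exists j0; rewrite // -ltnS -E; lia.
Qed.

Lemma cycle_vertex_inj k : injective (cycle_vertex k).
Proof.
move=> i j E; apply/val_inj => /=; apply/eqP; move/eqP: E.
rewrite /cycle_vertex nth_uniq //= ?size_map ?size_L //.
apply/andP; split; first by apply/mapP=> -[].
rewrite map_inj_uniq ?L_uniq //.
by apply: (inj_comp (f := inr)) (can_inj (translateK _)) => p r [].
Qed.

Lemma cycle_link_lev k a c : cycle_link k a c -> sedge (blowup_lev a) (blowup_lev c).
Proof.
case=> [[i /orP[]/eqP-> [-> ->]]|[i il [-> ->]]] /=; rewrite !nth_L //; try by rewrite ltnW.
- by rewrite W_first.
- by rewrite W_last.
- exact: W_path.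
Qed.

(** The level of the end vertex, 1 or 4, tells which end it is; its copy of Z_q then determines the
    base path through the given apex, and its residue the translation. *)
Lemma apex_inj (k k' : B * X * 'I_q) i i' :
  (i == 0) || (i == l) -> (i' == 0) || (i' == l) -> k.1.2 = k'.1.2 ->
  translate k.2 (nth p0 (L k.1) i) = translate k'.2 (nth p0 (L k'.1) i') -> k = k'.
Proof.
move=> i_end i'_end kk /[dup] /(congr1 fst) /=.
rewrite !nth_L; [|by case/orP: i'_end => /eqP->|by case/orP: i_end => /eqP->].
suff H : nth u0 (W k.1) i = nth u0 (W k'.1) i' -> k.1 = k'.1 /\ i = i'.
  move=> /H[E ->]; rewrite E => /translate_inj tau.
  by rewrite [k]surjective_pairing E tau -surjective_pairing.
case/orP: i_end i'_end => /eqP-> /orP[]/eqP-> E.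
- by split=> //; apply: W_first_inj E.
- by have := W_last k'.1 u0; rewrite -E W_first.
- by have := W_last k.1 u0; rewrite E W_first.
- by split=> //; apply: W_last_inj E.
Qed.

Lemma inner_inj (k k' : B * X * 'I_q) i i' a c : i < l -> i' < l ->
  col a c = col (nth p0 (L k.1) i) (nth p0 (L k.1) i.+1) ->
  col a c = col (nth p0 (L k'.1) i') (nth p0 (L k'.1) i'.+1) ->
  k.1 = k'.1 /\ i = i'.
Proof.
pose c0 := col p0 p0.
move=> il i'l; rewrite -(nth_links col p0 c0) ?size_L // => E.
rewrite -(nth_links col p0 c0) ?size_L // => E'.
have kk : k.1 = k'.1.
  apply: (@L_color_inj _ _ (col a c)).
    by rewrite E mem_nth // size_links size_L.
  by rewrite E' mem_nth // size_links size_L.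
split=> //; apply/eqP.
by rewrite -(nth_uniq c0 _ _ (L_color_uniq k.1)) ?size_links ?size_L // -E {1}E' kk.
Qed.

(** Cycles sharing an edge coincide: [apex_inj] settles edges at the apex, while for inner edges the
    colour determines the base path and the position, and then the residue gives the translation. *)
Lemma cycle_link_inj k k' a c : cycle_link k a c ->
  cycle_link k' a c \/ cycle_link k' c a -> k = k'.
Proof.
have inr_inj : injective (inr : P -> V) by move=> ? ? [].
case=> [[i iE [-> ->]]|[i il [-> ->]]] [] [[j jE []]|[j jl []]] //.
- by move=> [kk] /inr_inj; apply: apex_inj.
- have sdi : sd (nth p0 (L k.1) i).1 != sd (nth p0 (L k.1) i.+1).1.
    by rewrite !nth_L ?(ltnW il) //; apply/sedge_sd/W_path.
  move=> /inr_inj E /inr_inj E'.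
  have [kk ij] := @inner_inj k k' i j (translate k.2 (nth p0 (L k.1) i))
    (translate k.2 (nth p0 (L k.1) i.+1)) il jl (color_translate _ _ _ _)
    (etrans (congr2 col E E') (color_translate _ _ _ _)).
  move: E; rewrite kk ij => /translate_inj tau.
  by rewrite [k]surjective_pairing kk tau -surjective_pairing.
(* Opposite directions are impossible: the colour would give the same position in the same path, so
   the two ends of the edge would have equal parity. *)
- have sdi : sd (nth p0 (L k.1) i).1 != sd (nth p0 (L k.1) i.+1).1.
    by rewrite !nth_L ?(ltnW il) //; apply/sedge_sd/W_path.
  move=> /inr_inj E /inr_inj E'.
  have colE : col (translate k.2 (nth p0 (L k.1) i)) (translate k.2 (nth p0 (L k.1) i.+1)) =
      col (nth p0 (L k'.1) j) (nth p0 (L k'.1) j.+1).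
    by rewrite color_translate (color_sym sdi) -(color_translate _ k.2) E E' color_translate.
  have [kk ij] := inner_inj il jl (color_translate _ _ _ _) colE.
  by move/(congr1 (fun p => sd p.1)): E sdi => /= ->; rewrite kk ij eqxx.
Qed.

Lemma ex_cycle_ge_of_lifts n : #|X| + #|I| * q <= n ->
  #|B| * #|X| * q <= ex (cycle_graph l.+2) n (complete_graph 3).
Proof.
move=> xn.
have -> : #|B| * #|X| * q = #|{: B * X * 'I_q}| by rewrite !card_prod !card_ord.
apply: (@ex_triangle_ge _ _ _ _ _
  (fun k (i : cycle_graph l.+2) => cycle_vertex k i) blowup_lev).
- by exists ord0, (ordS ord0); rewrite cycle_sedgeP // eqxx.
- by rewrite card_sum card_prod !card_ord.
- exact: cycle_vertex_inj.
- move=> k k' i j i' j' ij ij' E E'.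
  have := cycle_linkP k' ij'; rewrite -E -E'.
  case: (cycle_linkP k ij) => H H'; apply: (cycle_link_inj H) => //.
  by apply/or_comm.
- exact: cycle5_triangle_free.
- move=> k i j /(cycle_linkP k) [] /cycle_link_lev //.
  by rewrite sedge_sym.
Qed.

End Assemble.

Section Walks.
Variables (I B X : finType) (lev : I -> cycle_graph 5) (q l : nat).
Variable W : B * X -> seq I.
Hypothesis lev_neq0 : forall u, lev u != ord0.
Hypothesis size_W : forall k, size (W k) = l.+1.
Hypothesis W_path : forall k u0 i, i < l ->
  sedge (lev (nth u0 (W k) i)) (lev (nth u0 (W k) i.+1)).
Hypothesis W_first : forall k u0, lev (nth u0 (W k) 0) = 1%R.
Hypothesis W_last : forall k u0, lev (nth u0 (W k) l) = 4%R.
Hypothesis W_first_inj : forall k k' u0, k.2 = k'.2 ->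
  nth u0 (W k) 0 = nth u0 (W k') 0 -> k = k'.
Hypothesis W_last_inj : forall k k' u0, k.2 = k'.2 ->
  nth u0 (W k) l = nth u0 (W k') l -> k = k'.
Hypothesis W_count : forall e,
  \sum_k count_mem e (links (step (fun u => odd (lev u))) (W k)) + l.+1 <= q.

(** [W_count] is a capacity condition: a pair of copies offers q colours, and l + 1 of them are
    reserved for the vertex collisions of the greedy lift. *)
Theorem ex_cycle_ge_walks n : #|X| + #|I| * q <= n ->
  #|B| * #|X| * q <= ex (cycle_graph l.+2) n (complete_graph 3).
Proof.
(* If q = 0 or there is no base walk, the bound is 0. Otherwise q is a successor, as the group
   structure requires, and some walk provides a default copy [u0]. *)
move=> xn; case: (posnP q) => [->|q0]; first by rewrite muln0.
case: (pickP {: B * X}) => [k0 _|no]; last first.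
  have : #|{: B * X}| = 0 by apply: eq_card0.
  by rewrite card_prod => ->.
have [u0 _] : {u0 : I | True}.
  by case: (W k0) (size_W k0) => // u ? _; exists u.
case: q q0 xn W_count => // q' _ xn Wc.
have [||e|L [LW /uniq_flatten_map [Lu Li]]] :=
    @greedy_walks I (fun u => odd (lev u)) q' _ W (enum {: B * X}) l.+1.
- exact: enum_uniq.
- by move=> k; rewrite size_W.
- apply: leq_trans (Wc e); rewrite leq_add2r count_flatten -map_comp sumnE.
  by rewrite big_map big_enum.
have E k : k \in enum {: B * X} by rewrite mem_enum.
apply: (@ex_cycle_ge_of_lifts _ _ _ lev q' l W _ _ _ _ _ _ _ u0 L) => // [k|k|k|k k' c].
- by have [] := LW k (E k).
- by have [] := LW k (E k).
- exact: Lu.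
- by apply: Li.
Qed.

End Walks.

(** * Zigzag base paths and their use of each pair of copies *)

Section Zigzag.
Variable T : eqType.

Fixpoint zigzag (r : nat) (u v : T) (s : seq T) : seq T :=
  if r is r'.+1 then [:: u, v & zigzag r' u v s] else s.

Lemma size_zigzag r u v s : size (zigzag r u v s) = 2 * r + size s.
Proof. by elim: r => //= r ->; lia. Qed.

Lemma last_zigzag x r u v s : last x (zigzag r.+1 u v s) = last v s.
Proof. by elim: r x => //= r IH x; rewrite (IH v). Qed.

Lemma sorted_zigzag (e : rel T) r u v s : e u v -> e v u ->
  sorted e (zigzag r.+1 u v s) = sorted e [:: u, v & s].
Proof.
move=> uv vu; elim: r => // r IH.
rewrite (_ : zigzag _ _ _ _ = [:: u, v & zigzag r.+1 u v s]) //.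
by rewrite -IH /= uv vu.
Qed.

Lemma count_links_zigzag (B : eqType) (c : T -> T -> B) e r u v s : c u v = c v u ->
  count_mem e (links c (zigzag r.+1 u v s)) =
  2 * r * (c u v == e) + count_mem e (links c [:: u, v & s]).
Proof.
move=> cuv; elim: r => // r IH.
have -> : links c (zigzag r.+2 u v s) = [:: c u v, c v u & links c (zigzag r.+1 u v s)] by [].
by move: IH => /= ->; rewrite -cuv; lia.
Qed.

End Zigzag.
Arguments zigzag : simpl never.

Lemma sum_inj_eq_le (T : finType) (T' : eqType) (g : T -> T') (c : pred T') (e : T') :
  injective g -> (forall x, c (g x)) -> \sum_x (g x == e) <= c e.
Proof.
move=> gI cg; have [/existsP[x /eqP gx]|no] := boolP [exists x, g x == e].
  rewrite (bigD1 x) //= gx eqxx big1 ?addn0 -?gx ?cg // => y yx.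
  by rewrite (inj_eq gI) (negbTE yx).
rewrite big1 // => x _; apply/eqP; rewrite eqb0; apply: contra no => gx.
by apply/existsP; exists x.
Qed.

Section ClusterWalks.
Variables (a b t mu2 mu3 : nat).

(** Indices of the copies of Z_q: [inl] for A2 and A5, [inr] for A3 and A4, the boolean separating
    the halves. Level i stands for the part A_(i+1). *)
Definition cluster : finType := (bool * ('I_a + 'I_b))%type.

Definition cluster_lev (u : cluster) : cycle_graph 5 :=
  match u with
  | (false, inl _) => @Ordinal 5 1 isT
  | (false, inr _) => @Ordinal 5 2 isT
  | (true, inr _) => @Ordinal 5 3 isT
  | (true, inl _) => @Ordinal 5 4 isT
  end.

(* The index of a base path: position and number of the zigzag, then the copies
   of Z_q visited in A3 and A4. *)
Definition apex : finType := (('I_mu2 + 'I_mu3 + 'I_mu2) * ('I_b * 'I_b))%type.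

(** Both ends use the same index [beta], which tells apart the [a] base paths through one apex. Each
    path has 2 t + 4 vertices, hence the cycle length 2 t + 5. *)
Definition cluster_walk (k : 'I_a * apex) : seq cluster :=
  let: (beta, (tau, (g3, g4))) := k in
  let p2 : cluster := (false, inl beta) in let p3 : cluster := (false, inr g3) in
  let p4 : cluster := (true, inr g4) in let p5 : cluster := (true, inl beta) in
  match tau with
  | inl (inl _) => zigzag t.+1 p2 p3 [:: p4; p5]
  | inl (inr _) => p2 :: zigzag t.+1 p3 p4 [:: p5]
  | inr _ => [:: p2, p3 & zigzag t.+1 p4 p5 [::]]
  end.

Lemma cluster_walkE beta g3 g4 :
  let p2 : cluster := (false, inl beta) in let p3 : cluster := (false, inr g3) in
  let p4 : cluster := (true, inr g4) in let p5 : cluster := (true, inl beta) in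
  ((forall i, cluster_walk (beta, (inl (inl i), (g3, g4))) = zigzag t.+1 p2 p3 [:: p4; p5]) *
   (forall i, cluster_walk (beta, (inl (inr i), (g3, g4))) = p2 :: zigzag t.+1 p3 p4 [:: p5]) *
   (forall i, cluster_walk (beta, (inr i, (g3, g4))) = [:: p2, p3 & zigzag t.+1 p4 p5 [::]]))%type.
Proof. by []. Qed.

Notation stp := (step (fun u => odd (cluster_lev u))).

Lemma size_cluster_walk k : size (cluster_walk k) = (2 * t + 3).+1.
Proof.
by case: k => beta [[[i|i]|i] [g3 g4]] /=; rewrite size_zigzag /=; lia.
Qed.

Lemma nth0_cluster_walk k u0 : nth u0 (cluster_walk k) 0 = (false, inl k.1).
Proof. by case: k => beta [[[i|i]|i] [g3 g4]]. Qed.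

Lemma last_cluster_walk k u0 : nth u0 (cluster_walk k) (2 * t + 3) = (true, inl k.1).
Proof.
rewrite -[2 * t + 3]/((2 * t + 3).+1.-1) -(size_cluster_walk k) nth_last.
by case: k => beta [[[i|i]|i] [g3 g4]]; rewrite cluster_walkE;
  [|rewrite last_cons|rewrite 2!last_cons]; rewrite last_zigzag.
Qed.

Lemma sorted_cluster_walk k :
  sorted (fun u v => sedge (cluster_lev u) (cluster_lev v)) (cluster_walk k).
Proof.
set e := fun _ => _.
have sorted_cons u v r w s :
    sorted e (u :: zigzag r.+1 v w s) = e u v && sorted e (zigzag r.+1 v w s).
  by [].
case: k => beta [[[i|i]|i] [g3 g4]]; rewrite cluster_walkE.
- by rewrite sorted_zigzag.
- by rewrite sorted_cons sorted_zigzag.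
- set s := _ :: zigzag _ _ _ _; rewrite -[sorted _ _]/(sorted e s) /s.
  by rewrite sorted_cons sorted_zigzag.
Qed.

Definition link23 (k : 'I_a * 'I_b) : cluster * cluster :=
  ((false, inr k.2), (false, inl k.1)).
Definition link34 (k : 'I_b * 'I_b) : cluster * cluster :=
  ((false, inr k.1), (true, inr k.2)).
Definition link45 (k : 'I_a * 'I_b) : cluster * cluster :=
  ((true, inl k.1), (true, inr k.2)).

Lemma count_cluster_walk beta tau g3 g4 e :
  let e2 := link23 (beta, g3) == e in let e3 := link34 (g3, g4) == e in
  let e4 := link45 (beta, g4) == e in
  count_mem e (links stp (cluster_walk (beta, (tau, (g3, g4))))) =
  e2 + e3 + e4 +
    2 * t * (match tau with inl (inl _) => e2 | inl (inr _) => e3 | inr _ => e4 end).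
Proof.
have s23 : stp (false, inl beta) (false, inr g3) = link23 (beta, g3) by [].
have s34 : stp (false, inr g3) (true, inr g4) = link34 (g3, g4) by [].
have s45 : stp (true, inr g4) (true, inl beta) = link45 (beta, g4) by [].
have count_cons u v r w s : count_mem e (links stp (u :: zigzag r.+1 v w s)) =
    (stp u v == e) + count_mem e (links stp (zigzag r.+1 v w s)) by [].
case: tau => [[i|i]|i]; rewrite cluster_walkE.
- by rewrite count_links_zigzag //= ?s23 ?s34 ?s45; lia.
- by rewrite count_cons count_links_zigzag //= ?s23 ?s34 ?s45; lia.
- set s := _ :: zigzag _ _ _ _.
  rewrite -[count_mem _ _]/(
    (stp (false, inl beta) (false, inr g3) == e) + count_mem e (links stp s)).
  by rewrite count_cons count_links_zigzag //= ?s23 ?s34 ?s45; lia.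
Qed.

(** The sum of levels is 3, 5 or 7 on the pairs A2 A3, A3 A4 and A4 A5. *)
Definition link_class (e : cluster * cluster) : nat := cluster_lev e.1 + cluster_lev e.2.

(** Every walk uses each of its three pairs once, and the zigzagged one 2 t more times. Fixing the
    pair [e] fixes two of [beta], [g3], [g4]; the third gives the factor [b] or [a]. *)
Lemma sum_count_cluster_walk e :
  \sum_k count_mem e (links stp (cluster_walk k)) <=
  (link_class e == 3) * (b * (2 * mu2 + mu3 + 2 * t * mu2)) +
  (link_class e == 5) * (a * (2 * mu2 + mu3 + 2 * t * mu3)) +
  (link_class e == 7) * (b * (2 * mu2 + mu3 + 2 * t * mu2)).
Proof.
pose S2 := \sum_(beta : 'I_a) \sum_(g3 : 'I_b) (link23 (beta, g3) == e).
pose S3 := \sum_(g3 : 'I_b) \sum_(g4 : 'I_b) (link34 (g3, g4) == e).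
pose S4 := \sum_(beta : 'I_a) \sum_(g4 : 'I_b) (link45 (beta, g4) == e).
have S2_le : S2 <= (link_class e == 3).
  rewrite /S2 pair_bigA /=.
  apply: (@sum_inj_eq_le _ _ (fun p => link23 (p.1, p.2)) (fun e => link_class e == 3)).
    by move=> [? ?] [? ?] [-> ->].
  by [].
have S3_le : S3 <= (link_class e == 5).
  rewrite /S3 pair_bigA /=.
  apply: (@sum_inj_eq_le _ _ (fun p => link34 (p.1, p.2)) (fun e => link_class e == 5)).
    by move=> [? ?] [? ?] [-> ->].
  by [].
have S4_le : S4 <= (link_class e == 7).
  rewrite /S4 pair_bigA /=.
  apply: (@sum_inj_eq_le _ _ (fun p => link45 (p.1, p.2)) (fun e => link_class e == 7)).
    by move=> [? ?] [? ?] [-> ->].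
  by [].
have sum_mid tau : \sum_(beta : 'I_a) \sum_(g3 : 'I_b) \sum_(g4 : 'I_b)
    count_mem e (links stp (cluster_walk (beta, (tau, (g3, g4))))) =
  b * S2 + a * S3 + b * S4 +
  2 * t * (match tau with inl (inl _) => b * S2 | inl (inr _) => a * S3 | inr _ => b * S4 end).
  have E2 : b * S2 =
      \sum_(beta : 'I_a) \sum_(g3 : 'I_b) \sum_(g4 : 'I_b) (link23 (beta, g3) == e).
    rewrite big_distrr; apply: eq_bigr => beta _; rewrite big_distrr; apply: eq_bigr => g3 _.
    by rewrite sum_nat_const card_ord.
  have E3 : a * S3 =
      \sum_(beta : 'I_a) \sum_(g3 : 'I_b) \sum_(g4 : 'I_b) (link34 (g3, g4) == e).
    by rewrite sum_nat_const card_ord.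
  have E4 : b * S4 =
      \sum_(beta : 'I_a) \sum_(g3 : 'I_b) \sum_(g4 : 'I_b) (link45 (beta, g4) == e).
    rewrite big_distrr; apply: eq_bigr => beta _.
    by rewrite sum_nat_const card_ord.
  under eq_bigr => beta _ do (under eq_bigr => g3 _ do
    (under eq_bigr => g4 _ do rewrite count_cluster_walk; rewrite !big_split /= -big_distrr /=);
    rewrite !big_split /= -big_distrr /=).
  rewrite !big_split /= -big_distrr /= -E2 -E3 -E4.
  by case: tau => [[i|i]|i]; rewrite -?E2 -?E3 -?E4.
rewrite (eq_bigr (fun k => count_mem e (links stp (cluster_walk
  (k.1, (k.2.1, (k.2.2.1, k.2.2.2)))))));
  last by case=> ? [? [? ?]].
rewrite -(pair_bigA _ (fun beta (c : apex) =>
  count_mem e (links stp (cluster_walk (beta, (c.1, (c.2.1, c.2.2))))))) /=.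
under eq_bigr => beta _ do (rewrite -(pair_bigA _ (fun tau (g : 'I_b * 'I_b) =>
  count_mem e (links stp (cluster_walk (beta, (tau, (g.1, g.2))))))) /=;
  under eq_bigr => tau _ do rewrite -(pair_bigA _ (fun g3 g4 =>
  count_mem e (links stp (cluster_walk (beta, (tau, (g3, g4))))))) /=).
rewrite exchange_big /=; under eq_bigr => tau _ do rewrite sum_mid.
rewrite !big_sumType /= !sum_nat_const !card_ord.
apply: (@leq_trans (S2 * (b * (2 * mu2 + mu3 + 2 * t * mu2)) +
  S3 * (a * (2 * mu2 + mu3 + 2 * t * mu3)) + S4 * (b * (2 * mu2 + mu3 + 2 * t * mu2)))).
  by apply: eq_leq; ring.
by rewrite !leq_add // leq_mul2r ?S2_le ?S3_le ?S4_le orbT.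
Qed.

End ClusterWalks.

(** [nu] is a free scale. The number of apexes is b (2 a + b) (2 t b nu), and every pair of copies
    is used at most U times. *)
Theorem ex_cycle_ge_weighted (a b t nu n : nat) :
  b <= a * (2 * t + 1) -> a <= b * (t + 1) ->
  b * (2 * a + b) * (2 * t * b * nu) +
    2 * (a + b) * (a * (2 * t + 3) * (2 * t * b * nu) + 2 * t + 4) <= n ->
  a * (b * (2 * a + b)) * (a * (2 * t + 3)) * (2 * t * b * nu) ^ 2 <=
    ex (cycle_graph (2 * t + 5)) n (complete_graph 3).
Proof.
move=> ba ab n_ge.
(* The ratio A : C of the zigzag multiplicities solves the balance equation b (2 A + C + 2 t A) = a
   (2 A + C + 2 t C); the hypotheses make both differences genuine. *)
set A := a * (2 * t + 1) - b; set C := 2 * (b * (t + 1) - a).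
pose mu2 := A * nu; pose mu3 := C * nu; pose U := a * (2 * t + 3) * (2 * t * b * nu).
have AE : A + b = a * (2 * t + 1) by rewrite subnK.
have CE : C + 2 * a = 2 * (b * (t + 1)) by rewrite -mulnDr subnK.
have AC : 2 * A + C = 2 * t * (2 * a + b) by lia.
have ACt : 2 * A + C + 2 * t * A = 2 * t * a * (2 * t + 3).
  by have := congr1 (muln (2 * t)) AE; lia.
have ACt' : 2 * A + C + 2 * t * C = 2 * t * b * (2 * t + 3).
  by have := congr1 (muln (2 * t)) CE; lia.
have cX : #|apex b mu2 mu3| = b * (2 * a + b) * (2 * t * b * nu).
  rewrite !card_prod !card_sum !card_ord.
  have -> : mu2 + mu3 + mu2 = (2 * A + C) * nu by rewrite /mu2 /mu3; ring.
  by rewrite AC; ring.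
have U2 : b * (2 * mu2 + mu3 + 2 * t * mu2) = U.
  have -> : 2 * mu2 + mu3 + 2 * t * mu2 = (2 * A + C + 2 * t * A) * nu.
    by rewrite /mu2 /mu3; ring.
  by rewrite ACt /U; ring.
have U3 : a * (2 * mu2 + mu3 + 2 * t * mu3) = U.
  have -> : 2 * mu2 + mu3 + 2 * t * mu3 = (2 * A + C + 2 * t * C) * nu.
    by rewrite /mu2 /mu3; ring.
  by rewrite ACt' /U; ring.
have -> : 2 * t + 5 = (2 * t + 3).+2 by lia.
(* Here q is the common load U plus the greedy slack 2 t + 4. *)
apply: leq_trans (@ex_cycle_ge_walks (cluster a b) _ _ (@cluster_lev a b)
  (U + (2 * t + 3).+1) _ (@cluster_walk a b t mu2 mu3) _ _ _ _ _ _ _ _ n _).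
- rewrite cX card_ord.
  apply: (@leq_trans (a * (b * (2 * a + b) * (2 * t * b * nu)) * U)).
    by apply: eq_leq; rewrite /U; ring.
  by rewrite leq_mul2l leq_addr orbT.
- by case=> [[] []].
- exact: size_cluster_walk.
- move=> k u0 i il; have /(sortedP u0) := sorted_cluster_walk t k.
  by apply; rewrite size_cluster_walk ltnS.
- by move=> k u0; rewrite nth0_cluster_walk; apply/val_inj.
- by move=> k u0; rewrite last_cluster_walk; apply/val_inj.
- move=> k k' u0 kk; rewrite !nth0_cluster_walk => -[E].
  by rewrite [k]surjective_pairing E kk -surjective_pairing.
- move=> k k' u0 kk; rewrite !last_cluster_walk => -[E].
  by rewrite [k]surjective_pairing E kk -surjective_pairing.
- move=> e; rewrite leq_add2r; apply: leq_trans; first exact: sum_count_cluster_walk.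
  rewrite U2 U3; case: (link_class e) => [|[|[|[|[|[|[|[|]]]]]]]] /=; lia.
- by rewrite cX card_prod card_bool card_sum !card_ord; lia.
Qed.

(** * Quadratic lower bound for every n, up to a linear error *)

Lemma sqr_le_of_le_add (n y F : nat) : n <= y + F -> n ^ 2 <= y ^ 2 + 2 * F * n.
Proof.
move=> n_le; have [nF|/ltnW Fn] := leqP n F.
  apply: leq_trans (leq_addl _ _); rewrite -mulnn leq_mul2r; apply/orP; right.
  by rewrite mul2n -addnn (leq_trans nF) // leq_addr.
have zy : n - F <= y by rewrite leq_subLR addnC.
apply: (@leq_trans ((n - F) ^ 2 + 2 * F * n)); last by rewrite leq_add2r leq_sqr.
rewrite -{1 3}(subnK Fn); move: (n - F) => z; rewrite sqrnD -addnA leq_add2l mulnDr.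
rewrite -[F ^ 2]mulnn; lia.
Qed.

(** The largest scale that fits into n wastes at most E + D N vertices, independently of n. *)
Lemma quotient_scale (n D N E : nat) : 0 < D -> 0 < N ->
  exists nu, (E <= n -> D * (N * nu) + E <= n) /\ n <= D * (N * nu) + (E + D * N).
Proof.
move=> D0 N0; exists ((n - E) %/ (D * N)); rewrite mulnA mulnC.
have := leq_divM (n - E) (D * N); have := ltn_ceil (n - E) (_ : 0 < D * N).
rewrite muln_gt0 D0 N0 => /(_ isT); set X := D * N; set v := _ %/ _.
by rewrite mulSn; move: (v * X) => w; lia.
Qed.

Lemma ex_cycle_ge_quadratic (a b t : nat) :
  0 < a -> 0 < b -> 0 < t -> b <= a * (2 * t + 1) -> a <= b * (t + 1) ->
  exists C, forall n, a * (b * (2 * a + b)) * (a * (2 * t + 3)) * n ^ 2 <=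
    (b * (2 * a + b) + 2 * (a + b) * (a * (2 * t + 3))) ^ 2 *
      ex (cycle_graph (2 * t + 5)) n (complete_graph 3) + C * n.
Proof.
move=> a0 b0 t0 ba ab.
(* With x = N nu, the construction packs K x^2 cycles on D x + E vertices. *)
set K := _ * (a * (2 * t + 3)); set D := _ + _ * (a * (2 * t + 3)).
have D0 : 0 < D by rewrite /D ltn_addr // !muln_gt0 addn_gt0 b0 orbT.
pose N := 2 * t * b; pose E := 2 * (a + b) * (2 * t + 4).
have N0 : 0 < N by rewrite /N !muln_gt0 t0.
exists (K * (2 * (E + D * N))) => n; set e := ex _ _ _.
have [y y_le n_le] : exists2 y, K * y ^ 2 <= D ^ 2 * e & n <= y + (E + D * N).
  have [nu [nu_le n_le]] := @quotient_scale n D N E D0 N0.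
  (* Up to E vertices nothing is packed, and y = 0 is absorbed by the error. *)
  have [nE|/ltnW nE] := leqP n E.
    by exists 0; rewrite ?muln0 // add0n (leq_trans nE) // leq_addr.
  exists (D * (N * nu)) => //; rewrite expnMn mulnCA leq_mul2l; apply/orP; right.
  apply: ex_cycle_ge_weighted => //; rewrite -/N; apply: leq_trans (nu_le nE).
  by apply: eq_leq; rewrite /D /E; move: (N * nu) => x; ring.
apply: (@leq_trans (K * (y ^ 2 + 2 * (E + D * N) * n))).
  by rewrite leq_mul2l sqr_le_of_le_add ?orbT.
by rewrite mulnDr leq_add // mulnA.
Qed.

(* Limits of the density and the choice of weights *)
From mathcomp Require Import all_classical all_reals all_analysis.
Import Order.TTheory GRing.Theory Num.Theory.
Import numFieldNormedType.Exports.
Local Open Scope ring_scope.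

Lemma limn_esup_le_near (R : realType) (u : nat -> \bar R) (c : \bar R) (N : nat) :
  (forall n, (N <= n)%N -> u n <= c)%E -> (limn_esup u <= c)%E.
Proof.
move=> u_le; apply: (@le_trans _ _ (ereal_sup (u @` [set n | (N <= n)%N])%classic)).
  apply: ereal_inf_lbound; exists [set n | (N <= n)%N]%classic => //.
  by exists N.
by apply: ge_ereal_sup => _ [n /u_le le <-].
Qed.

Lemma limn_einf_ge_near (R : realType) (u : nat -> \bar R) (c : \bar R) (N : nat) :
  (forall n, (N <= n)%N -> c <= u n)%E -> (c <= limn_einf u)%E.
Proof.
move=> u_ge; rewrite leeNr; apply: (@limn_esup_le_near _ _ _ N) => n /u_ge.
by rewrite leeN2.
Qed.

Section Quadratic.
Variables (R : realType) (e : nat -> nat) (P Q C : nat).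
Hypothesis Q_gt0 : (0 < Q)%N.

Let density n : \bar R := ((e n)%:R / n%:R ^+ 2)%:E.

(** From some n on, C n is at most eps Q n^2, so a linear error does not affect either limit. *)
Let linear_error (eps : R) : 0 < eps -> exists2 N, (0 < N)%N &
  forall n, (N <= n)%N -> C%:R <= Q%:R * eps * n%:R.
Proof.
move=> e0; have Qe : 0 < Q%:R * eps by rewrite mulr_gt0 // ltr0n.
exists (Num.bound (C%:R / (Q%:R * eps))).+1 => // n Nn.
rewrite mulrC -ler_pdivrMr //; apply: ltW.
apply: lt_le_trans (archi_boundP _) _; first by rewrite divr_ge0 // ltW.
by rewrite ler_nat ltnW.
Qed.

Lemma limn_einf_ge_quadratic :
  (forall n, P * n ^ 2 <= Q * e n + C * n)%N -> ((P%:R / Q%:R)%:E <= limn_einf density)%E.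
Proof.
move=> H; apply/lee_subgt0Pr => eps e0; have [N N0 NC] := linear_error e0.
apply: (@limn_einf_ge_near _ _ _ N) => n Nn; rewrite -EFinB lee_fin.
have n0 : 0 < n%:R :> R by rewrite ltr0n (leq_trans N0).
have Q0 : 0 < Q%:R :> R by rewrite ltr0n.
rewrite lerBlDr ler_pdivrMr // mulrDl mulrAC.
rewrite -(ler_pM2r (exprn_gt0 2 n0)) mulrDl divfK ?gt_eqF ?exprn_gt0 //.
have Hn : P%:R * n%:R ^+ 2 <= Q%:R * (e n)%:R + C%:R * n%:R :> R.
  by rewrite -natrX -!natrM -natrD ler_nat.
apply: le_trans Hn _; rewrite [X in _ <= X + _]mulrC lerD2l expr2 mulrA ler_pM2r //.
by rewrite [eps * _]mulrC; apply: NC.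
Qed.

Lemma limn_esup_le_quadratic :
  (forall n, Q * e n <= P * n ^ 2 + C * n)%N -> (limn_esup density <= (P%:R / Q%:R)%:E)%E.
Proof.
move=> H; apply/lee_addgt0Pr => eps e0; have [N N0 NC] := linear_error e0.
apply: (@limn_esup_le_near _ _ _ N) => n Nn; rewrite -EFinD lee_fin.
have n0 : 0 < n%:R :> R by rewrite ltr0n (leq_trans N0).
have Q0 : 0 < Q%:R :> R by rewrite ltr0n.
rewrite ler_pdivrMr ?exprn_gt0 // mulrDl -(ler_pM2l Q0) mulrDr.
have Hn : Q%:R * (e n)%:R <= P%:R * n%:R ^+ 2 + C%:R * n%:R :> R.
  by rewrite -natrX -!natrM -natrD ler_nat.
apply: le_trans Hn _; have -> : Q%:R * (P%:R / Q%:R * n%:R ^+ 2) = P%:R * n%:R ^+ 2 :> R.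
  by rewrite mulrA [Q%:R * _]mulrC divfK // gt_eqF.
by rewrite lerD2l expr2 !mulrA ler_pM2r //; apply: NC.
Qed.

End Quadratic.

(** Weights (3, 4) with M = m - 2 give the density 360 M / (40 + 42 M)^2, to be compared with 1 / (5
    (M + 2)). The difference of the sides is 36 M^2 + 240 M - 1600, positive from M = 5, that is k =
    3. *)
Lemma pentagon_weights_nat (M : nat) : (5 <= M)%N ->
  ((40 + 42 * M) ^ 2 < 1800 * (M * (M + 2)))%N.
Proof. by move=> M5; rewrite -mulnn; nia. Qed.

(** For weights (1, L), B = L + 1 and M = m - 2, division by 4 B^2 (B^2 - 1 + 2 B M)^2 turns this
    into: m times the density is at least 1/4 - 3 / (4 B^2). *)
Lemma bipartite_weights (R : realFieldType) (B M : R) : 2 <= B -> B ^+ 3 <= M ->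
  B ^+ 2 * (B ^+ 2 - 1 + 2 * B * M) ^+ 2 <=
    4 * (M + 2) * ((B ^+ 2 - 1) * M) * B ^+ 2 + 3 * (B ^+ 2 - 1 + 2 * B * M) ^+ 2.
Proof.
move=> B2 BM; have B4 : 4 <= B ^+ 2 by nra.
have BleM : B <= M by apply: le_trans BM; rewrite exprS; nra.
have B0 : 0 <= B by lra.
have M0 : 0 <= M by lra.
rewrite -lerBlDr -mulrBl.
have Q_le : (B ^+ 2 - 1 + 2 * B * M) ^+ 2 <= (B * (B + 2 * M)) ^+ 2.
  by rewrite ler_sqr ?nnegrE; nra.
apply: (@le_trans _ _ ((B ^+ 2 - 3) * (B * (B + 2 * M)) ^+ 2)).
  by apply: ler_wpM2l => //; lra.
have sq_le : (B + 2 * M) ^+ 2 <= 4 * M ^+ 2 + 5 * M * B by nra.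
(* The cross term 5 M B^3 is at most 5 M^2, which the gap of 8 M^2 absorbs; hence the requirement
   B^3 <= M. *)
have step : (B ^+ 2 - 3) * (B + 2 * M) ^+ 2 <= 4 * M ^+ 2 * (B ^+ 2 - 1).
  apply: (@le_trans _ _ ((B ^+ 2 - 3) * (4 * M ^+ 2 + 5 * M * B))).
    by apply: ler_wpM2l => //; lra.
  have : M * B ^+ 3 <= M * M by apply: ler_wpM2l.
  have : 0 <= M * B by apply: mulr_ge0.
  rewrite (_ : B ^+ 3 = B ^+ 2 * B); last by rewrite exprSr.
  move: (B ^+ 2) => C; rewrite expr2; nra.
have B20 : 0 <= B ^+ 2 by lra.
have := ler_wpM2l B20 step; have : 0 <= B ^+ 2 * ((B ^+ 2 - 1) * M).
  by rewrite !mulr_ge0 //; lra.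
rewrite exprMn; move: (B ^+ 2) ((B + 2 * M) ^+ 2) => C S; rewrite expr2; nra.
Qed.

(** * The two density bounds and the limit 1/4 *)

Section Density.
Variable R : realType.

Notation density k := (ex_density R (cycle_graph (2 * k + 1)) (complete_graph 3)).

Lemma limn_esup_density_le (k : nat) : (0 < k)%N ->
  (limn_esup (density k) <= (1 / (4 * (2 * k + 1)%:R))%:E)%E.
Proof.
move=> k0; have -> : 1 / (4 * (2 * k + 1)%:R) = 1%:R / (4 * (2 * k + 1))%:R :> R.
  by rewrite natrM.
apply: (@limn_esup_le_quadratic R _ _ _ 3) => [|n]; first by rewrite addn1.
rewrite mul1n -mulnA; apply: ex_cycle_triangle_le; lia.
Qed.

Lemma limn_einf_density_ge (a b t : nat) : (0 < a)%N -> (0 < b)%N -> (0 < t)%N ->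
  (b <= a * (2 * t + 1))%N -> (a <= b * (t + 1))%N ->
  (((a * (b * (2 * a + b)) * (a * (2 * t + 3)))%:R /
    ((b * (2 * a + b) + 2 * (a + b) * (a * (2 * t + 3))) ^ 2)%:R)%:E <=
   limn_einf (density (t + 2)))%E.
Proof.
move=> a0 b0 t0 ba ab; have [C H] := ex_cycle_ge_quadratic a0 b0 t0 ba ab.
have -> : (2 * (t + 2) + 1 = 2 * t + 5)%N by lia.
apply: (@limn_einf_ge_quadratic R _ _ _ C) => //.
by rewrite expn_gt0 addn_gt0 muln_gt0 b0 addn_gt0 b0 orbT.
Qed.

Lemma limn_einf_density_gt (k : nat) : (2 < k)%N ->
  ((1 / (5 * (2 * k + 1)%:R))%:E < limn_einf (density k))%E.
Proof.
move=> k2; have [t t0 ->] : exists2 t, (0 < t)%N & k = (t + 2)%N.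
  by exists (k - 2)%N; lia.
apply: lt_le_trans (limn_einf_density_ge (a := 3) (b := 4) _ _ t0 _ _) => //; try lia.
rewrite lte_fin -natrM ltr_pdivrMr; last by rewrite ltr0n; lia.
rewrite mulrAC ltr_pdivlMr; last by rewrite ltr0n expn_gt0.
rewrite mul1r -natrM ltr_nat.
have M5 : (5 <= 2 * t + 3)%N by lia.
have := pentagon_weights_nat M5; set M := (2 * t + 3)%N.
have -> : (2 * (t + 2) + 1 = M + 2)%N by rewrite /M; lia.
have -> : (4 * (2 * 3 + 4) + 2 * (3 + 4) * (3 * M) = 40 + 42 * M)%N by ring.
by move/leq_trans; apply; apply: eq_leq; ring.
Qed.

Lemma near_limn_einf_density (eps : R) : 0 < eps ->
  exists N, forall k, (N <= k)%N ->
    ((1 / 4 - eps)%:E <= (2 * k + 1)%:R%:E * limn_einf (density k))%E.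
Proof.
(* B exceeds 1 / eps, so the loss 3 / (4 B^2) is at most eps, and k >= B^3 + 2 ensures B^3 <= M. *)
move=> e0; pose L := (Num.bound (1 / eps)).+1; pose B := L.+1.
exists (B ^ 3 + 2)%N => k kB; pose t := (k - 2)%N.
have B3 : (B <= B ^ 3)%N by rewrite -{1}[B]expn1 leq_exp2l.
have kE : k = (t + 2)%N by rewrite /t subnK // (leq_trans _ kB) // leq_addl.
have Bt : (B ^ 3 <= t)%N by rewrite /t leq_subRL ?(leq_trans _ kB) ?leq_addl // addnC.
have t0 : (0 < t)%N by apply: leq_trans Bt; rewrite expn_gt0.
have Lt : (L < t)%N by apply: leq_trans Bt.
rewrite kE; clearbody t.
have L_le : (L <= 1 * (2 * t + 1))%N by lia.
have ab : (1 <= L * (t + 1))%N by rewrite muln_gt0 addn_gt0 orbT.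
have low := limn_einf_density_ge (isT : 0 < 1)%N (isT : 0 < L)%N t0 L_le ab.
have m0 : 0 <= (2 * (t + 2) + 1)%:R :> R by [].
apply: le_trans (lee_wpmul2l _ low); last by rewrite lee_fin.
rewrite -EFinM lee_fin.
set Q := (_ ^ 2)%N; set P := (_ * (1 * _))%N.
have Q0 : 0 < Q%:R :> R by rewrite ltr0n expn_gt0 addn_gt0.
rewrite mulrA ler_pdivlMr //.
pose Br : R := B%:R; pose M : R := (2 * t + 3)%:R.
have BE : Br = L%:R + 1 by rewrite natr1.
have QE : Q%:R = (Br ^+ 2 - 1 + 2 * Br * M) ^+ 2.
  rewrite /Q natrX; congr (_ ^+ 2); rewrite BE /M !(natrD, natrM); ring.
have PE : P%:R = (Br ^+ 2 - 1) * M.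
  rewrite /P BE /M !(natrD, natrM); ring.
have mE : (2 * (t + 2) + 1)%:R = M + 2.
  by rewrite /M !(natrD, natrM); ring.
have B2 : 2 <= Br by rewrite ler_nat.
have BM : Br ^+ 3 <= M by rewrite -natrX ler_nat; lia.
have eB : 1 <= eps * Br.
  rewrite mulrC -ler_pdivrMr //; apply: ltW; apply: lt_le_trans (archi_boundP _) _.
    by rewrite divr_ge0 // ltW.
  by rewrite ler_nat (leq_trans (leqnSn _)) // leqnSn.
have := bipartite_weights B2 BM; rewrite -QE -PE -mE => key.
have B20 : 0 < Br ^+ 2 by rewrite exprn_gt0 //; lra.
rewrite -(ler_pM2r B20).
have eB2 : 3 <= 4 * eps * Br ^+ 2 by rewrite expr2; nra.
have := ler_wpM2r (ltW Q0) eB2; move: key.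
move: (Br ^+ 2) (P%:R : R) (Q%:R : R) ((2 * (t + 2) + 1)%:R : R) => b p q m; nra.
Qed.

(** Convergence in the extended reals asks for eventually finite terms: the lower bound with eps = 1
    and the upper bound 1/4 provide this. *)
Lemma cvg_quarter (x : nat -> \bar R) :
  (forall k, (0 < k)%N -> (x k <= (1 / 4)%:E)%E) ->
  (forall eps : R, 0 < eps ->
     exists N, forall k, (N <= k)%N -> ((1 / 4 - eps)%:E <= x k)%E) ->
  (x k @[k --> \oo] --> ((1 / 4 : R)%:E : \bar R))%classic.
Proof.
move=> x_le x_ge; apply/fine_cvgP.
have fin k N : (forall k, (N <= k)%N -> ((1 / 4 - 1)%:E <= x k)%E) -> (N < k)%N ->
    x k \is a fin_num.
  move=> HN Nk; rewrite fin_numElt; apply/andP; split.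
    by apply: lt_le_trans (HN _ (ltnW Nk)); rewrite ltNyr.
  by apply: le_lt_trans (x_le _ _) _; rewrite ?ltry //; case: k Nk.
have [N HN] := x_ge _ (ltr01 : 0 < 1 :> R).
split; first by exists N.+1 => // k /= Nk; apply: fin HN Nk.
apply/cvgrPdist_le => eps e0; have [N' HN'] := x_ge _ e0.
exists (maxn N.+1 N') => // k /=; rewrite geq_max => /andP[Nk N'k].
have xfin := fin _ _ HN Nk.
have := HN' _ N'k; have := x_le k (leq_ltn_trans (leq0n N) Nk).
rewrite -(fineK xfin) !lee_fin => h1 h2.
by rewrite ger0_norm; lra.
Qed.

Lemma scaled_limn_esup_density_le (k : nat) : (0 < k)%N ->
  ((2 * k + 1)%:R%:E * limn_esup (density k) <= (1 / 4 : R)%:E)%E.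
Proof.
move=> k0; have m0 : 0 < (2 * k + 1)%:R :> R by rewrite ltr0n addn1.
apply: le_trans (lee_wpmul2l _ (limn_esup_density_le k0)) _; first by rewrite lee_fin ltW.
by rewrite -EFinM lee_fin le_eqVlt; apply/orP; left; apply/eqP; field; rewrite gt_eqF.
Qed.

Lemma scaled_limn_einf_le_esup (k : nat) :
  ((2 * k + 1)%:R%:E * limn_einf (density k) <= (2 * k + 1)%:R%:E * limn_esup (density k))%E.
Proof. by apply: lee_wpmul2l; rewrite ?lee_fin // limn_einf_sup. Qed.

End Density.

Local Open Scope classical_set_scope.

Theorem theorem1p7 (R : realType) :
  (forall k : nat, (2 < k)%N ->
    ((1 / (5 * (2 * k + 1)%:R))%:E <
      limn_einf (ex_density R (cycle_graph (2 * k + 1)) (complete_graph 3)))%E)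
  /\
  ((((2 * k + 1)%:R : R)%:E *
      limn_einf (ex_density R (cycle_graph (2 * k + 1)) (complete_graph 3)))%E
    @[k --> \oo] --> ((1 / 4 : R)%:E : \bar R))
  /\
  ((((2 * k + 1)%:R : R)%:E *
      limn_esup (ex_density R (cycle_graph (2 * k + 1)) (complete_graph 3)))%E
    @[k --> \oo] --> ((1 / 4 : R)%:E : \bar R)).
Proof.
split; first exact: limn_einf_density_gt.
(* Both sequences lie below 1/4 through the upper limit and eventually above 1/4 - eps through the
   lower limit. *)
split; apply: cvg_quarter => [k k0|eps /near_limn_einf_density[N H]].
- exact: le_trans (scaled_limn_einf_le_esup _ _) (scaled_limn_esup_density_le _ k0).
- by exists N.
- exact: scaled_limn_esup_density_le.
- by exists N => k /H /le_trans; apply; apply: scaled_limn_einf_le_esup.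
Qed.
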